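(* Let $V$ be a free $\mathbb{Z}$-module of finite rank with an alternating bilinear form $B:V\otimes V\to\mathbb{Z}$. Let $G$ be a finitely generated group acting on $V$, and assume that there are generators $g_1,\dots,g_n$ of $G$ and elements $e_1,\dots,e_n\in V$ such that $g_i v=v-B(v,e_i)e_i$ for all $v\in V$ and all $i$. Assume furthermore that $\Delta=G\cdot\{e_1,\dots,e_n\}$ is a (skew-symmetric) vanishing lattice in $V$. Let $V_{\mathbb{Q}}=V\otimes\mathbb{Q}$. Then the restriction map $$H^1(G,V_{\mathbb{Q}})\to\prod_{g\in G}V_{\mathbb{Q}}/(g-\mathrm{id})V_{\mathbb{Q}}$$ is injective.
   Context: For $v\in V$, the symplectic transvection $T_v$ is the automorphism $T_v(x)=x-B(x,v)v$ of $V$. For a subset $\Delta\subseteq V$, $\Gamma_\Delta$ is the group generated by all $T_\delta$ with $\delta\in\Delta$. A (skew-symmetric) vanishing lattice in $V$ is a subset $\Delta\subseteq V$ such that: (1) $\Delta$ generates $V$; (2) $\Delta$ is a single orbit under the action of $\Gamma_\Delta$; (3) there exist $\delta_1,\delta_2\in\Delta$ with $B(\delta_1,\delta_2)=1$. For a $G$-module $M$, $H^1(G,M)=Z^1(G,M)/B^1(G,M)$, where $Z^1(G,M)$ is the group of maps $\phi:G\to M$ with $\phi(gh)=g\cdot\phi(h)+\phi(g)$ for all $g,h\in G$, and $B^1(G,M)$ is the group of maps of the form $g\mapsto g\cdot x-x$ with $x\in M$. The restriction map takes the class of a $1$-cocycle $\phi$ to the element of the product with components $\phi(g)+(g-\mathrm{id})M$.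 *)

(* Defs.v *)
From HB Require Import structures.
From mathcomp Require Import all_boot all_order all_algebra.
From mathcomp Require Import boolp classical_sets functions.

Set Implicit Arguments.
Unset Strict Implicit.
Unset Printing Implicit Defensive.

Import GRing.Theory.
Local Open Scope classical_set_scope.
Local Open Scope ring_scope.
Local Open Scope quotient_scope.

(* Z-linear maps are exactly additive maps, so a Z[G]-module structure on M is
   an action of G by additive endomorphisms. *)
Record gmodule (G : groupType) (M : zmodType) := GModule {
  gact :> G -> {additive M -> M};
  gact1 : forall x, gact 1%g x = x;
  gactM : forall g h x, gact (g * h)%g x = gact g (gact h x)
}.

Section FirstCohomology.
Context {G : groupType} {M : zmodType} (rho : gmodule G M).

Definition cocycle : {pred G -> M} :=
  fun phi => `[< forall g h, phi (g * h)%g = rho g (phi h) + phi g >].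

Fact cocycle_zmod_closed : zmod_closed cocycle.
Proof.
split=> [|phi psi /asboolP Zphi /asboolP Zpsi]; apply/asboolP => g h.
  by rewrite [LHS]/= raddf0 addr0.
by rewrite /GRing.add /GRing.opp /= Zphi Zpsi raddfB opprD addrACA.
Qed.
HB.instance Definition _ :=
  GRing.isZmodClosed.Build _ cocycle cocycle_zmod_closed.

Definition Z1 := {phi : G -> M | phi \in cocycle}.
HB.instance Definition _ := [isSub of Z1 for @sval _ _].
HB.instance Definition _ := [Choice of Z1 by <:].
HB.instance Definition _ := [SubChoice_isSubZmodule of Z1 by <:].

Definition B1 : {pred Z1} :=
  fun phi => `[< exists x, forall g, val phi g = rho g x - x >].

Fact B1_zmod_closed : zmod_closed B1.
Proof.
split=> [|phi psi /asboolP[x phiE] /asboolP[y psiE]]; apply/asboolP.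
  by exists 0 => g; rewrite raddf0 subr0.
exists (x - y) => g; have -> : val (phi - psi) g = val phi g - val psi g by [].
by rewrite phiE psiE raddfB !opprD addrACA.
Qed.
HB.instance Definition _ := GRing.isZmodClosed.Build Z1 B1 B1_zmod_closed.

Definition H1 := Quotient.quot B1.

(* The subgroup (g - id) M of M. *)
Definition displacement (g : G) : {pred M} :=
  fun y => `[< exists x, y = rho g x - x >].

Fact displacement_zmod_closed g : zmod_closed (displacement g).
Proof.
split=> [|y z /asboolP[x ->] /asboolP[x' ->]]; apply/asboolP.
  by exists 0; rewrite raddf0 subr0.
by exists (x - x'); rewrite raddfB !opprD addrACA.
Qed.
HB.instance Definition _ g :=
  GRing.isZmodClosed.Build M (displacement g) (displacement_zmod_closed g).

Definition displacement_quotient (g : G) := Quotient.quot (displacement g).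

(* [restrictionE] below shows independence of the representative. *)
Definition restriction (c : H1) (g : G) : displacement_quotient g :=
  \pi_(displacement_quotient g) (val (repr c) g).

Lemma restrictionE (phi : Z1) g :
  restriction (\pi_H1 phi) g = \pi_(displacement_quotient g) (val phi g).
Proof.
apply/eqP; rewrite -Quotient.idealrBE; apply/asboolP.
have /asboolP[x xE] : repr (\pi_H1 phi) - phi \in B1.
  by rewrite Quotient.idealrBE reprK.
by exists x; rewrite -xE.
Qed.

End FirstCohomology.
Arguments restriction {G M} rho c g.

(* Extension of scalars V (x) Q, through its universal property: additive maps
   from V to a Q-vector space extend uniquely to Q-linear maps. *)
Record rationalization (V : zmodType) := Rationalization {
  rat_space :> lmodType rat;
  rat_map : {additive V -> rat_space};
  rat_universal : forall (W : lmodType rat) (f : {additive V -> W}),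
    exists h : {linear rat_space -> W},
      (forall v, h (rat_map v) = f v) /\
      (forall h' : {linear rat_space -> W},
         (forall v, h' (rat_map v) = f v) -> h' =1 h)
}.

Section RationalAction.
Context {G : groupType} {V : zmodType}.
Variables (rho : gmodule G V) (VQ : rationalization V).

Lemma rat_linear_ext (W : lmodType rat) (h h' : {linear VQ -> W}) :
  (forall v, h (rat_map VQ v) = h' (rat_map VQ v)) -> h =1 h'.
Proof.
move=> hh' x; have [k [_ kP]] := rat_universal VQ (h' \o rat_map VQ).
by rewrite (kP h) // (kP h').
Qed.

Definition rat_act (g : G) : {linear VQ -> VQ} :=
  projT1 (cid (rat_universal VQ (rat_map VQ \o rho g))).

Lemma rat_actE g v : rat_act g (rat_map VQ v) = rat_map VQ (rho g v).
Proof. by rewrite /rat_act; case: cid => h [hE _] /=; rewrite hE. Qed.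

Fact rat_act1 x : rat_act 1%g x = x.
Proof.
by apply: (rat_linear_ext (h' := idfun)) => v; rewrite rat_actE gact1.
Qed.

Fact rat_actM g h x : rat_act (g * h)%g x = rat_act g (rat_act h x).
Proof.
apply: (rat_linear_ext (h' := rat_act g \o rat_act h)) => v /=.
by rewrite !rat_actE gactM.
Qed.

Definition rat_gmodule : gmodule G VQ := GModule rat_act1 rat_actM.

End RationalAction.

Definition free_of_finite_rank (V : lmodType int) :=
  exists r (b : 'I_r -> V),
    forall v, exists! c : {ffun 'I_r -> int}, v = \sum_i c i *: b i.

Definition group_generated (G : groupType) (S : set G) : set G :=
  smallest [set H : set G |
    H 1%g /\ forall g h, H g -> H h -> H (g * h^-1)%g] S.

Definition span_int (V : lmodType int) (S : set V) : set V :=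
  smallest [set A : set V |
    A 0 /\ forall (k : int) x y, A x -> A y -> A (k *: x + y)] S.

(* The subgroup of the permutations of T generated by a set S of them. *)
Definition perm_generated (T : Type) (S : set (T -> T)) : set (T -> T) :=
  smallest [set A : set (T -> T) |
    [/\ A id,
        forall f g, A f -> A g -> A (f \o g)
      & forall f f', A f -> cancel f f' -> cancel f' f -> A f']] S.

Section VanishingLattice.
Context {V : lmodType int} (B : {biscalar V}).

Definition alternating := forall v, B v v = 0.

Definition transvection (v x : V) : V := x - B x v *: v.

Definition transvection_group (Delta : set V) : set (V -> V) :=
  perm_generated [set transvection d | d in Delta].

Definition vanishing_lattice (Delta : set V) : Prop :=
  [/\ span_int Delta = setT,
      exists2 d, Delta d & Delta = [set f d | f in transvection_group Delta]
    & exists d1 d2, [/\ Delta d1, Delta d2 & B d1 d2 = 1]].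

End VanishingLattice.

(* Main.v *)
(* A cocycle phi that is locally a coboundary satisfies phi(t) = c(d) d for any
   t acting as the transvection T_d, d in Delta, and the cocycle identity gives
   c(T_d u) = c(u) - B(u,d) c(d).  The class of phi vanishes as soon as
   sum_i k_i c(e_i) = 0 whenever sum_i k_i e_i is in the radical of B.

   The lifted set D = {(d, c(d))} in V + Q, with the form pulled back from V, is
   again closed under its own transvections and is a single orbit.  For such a
   set D, with a, b in D and B(a,b) = 1, every r in the span of D that lies in
   the radical has a multiple N r, N <> 0, with a + N r in D: the set X of the x
   orthogonal to a and b with a + x in D is stable under y |-> y +- 2x for x in
   X, hence under translation by 2<X>, and a nonzero multiple of each element of
   D lies in Z a + Z b + <X>.  Applied to r = sum_i k_i (e_i, c(e_i)) =: (r1, r2)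
   this gives c(a + N r1) = c(a) + N r2.  If t and t' act as the transvections
   along a and a + N r1, then t' t^-1 moves V into the radical, so the local
   condition at t' t^-1 forces c(a + N r1) = c(a), that is r2 = 0. *)
Require Import Defs.
From HB Require Import structures.
From mathcomp Require Import all_boot all_order all_algebra.
From mathcomp Require Import boolp classical_sets functions.
From mathcomp Require Import ring zify.

Set Implicit Arguments.
Unset Strict Implicit.
Unset Printing Implicit Defensive.

Import GRing.Theory Num.Theory.
Local Open Scope classical_set_scope.
Local Open Scope ring_scope.

Lemma alternating_anticomm (V : lmodType int) (B : {biscalar V}) :
  alternating B -> forall u v, B u v = - B v u.
Proof.
move=> B_alt u v; apply/eqP; rewrite -addr_eq0.
have := B_alt (u + v).
by rewrite linearDl !linearDr /= !B_alt add0r addr0 addrC => ->.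
Qed.

(** * Sets closed under their own transvections, and their translation by radical vectors *)

Section TransvectionInvariantSet.
Context (U : lmodType int) (B : {biscalar U}) (B_alt : alternating B).
Context (D : set U).
Context (D_transvection : forall d u, D d -> D u ->
  D (u - B u d *: d) /\ D (u + B u d *: d)).

Let Bss u : B u u = 0. Proof. exact: B_alt. Qed.
Let BC u v : B u v = - B v u. Proof. exact: alternating_anticomm. Qed.

(** Adding a multiple of [d] leaves [B u d] unchanged, so steps of either sign can be iterated. *)
Lemma transvection_expz d u (k : int) : D d -> D u -> D (u + (k * B u d) *: d).
Proof.
move=> Dd Du.
have step (l : nat) (s : int) : s = 1 \/ s = -1 ->
    D (u + (s * l%:Z * B u d) *: d).
  move=> s1; elim: l => [|l IH]; first by rewrite mulr0 mul0r scale0r addr0.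
  have BE : B (u + (s * l%:Z * B u d) *: d) d = B u d.
    by rewrite linearDl linearZl_LR /= Bss mulr0 addr0.
  have [Hm Hp] := D_transvection Dd IH; rewrite BE -!addrA in Hm Hp.
  rewrite -scalerBl in Hm; rewrite -scalerDl in Hp.
  case: s1 => sE; rewrite sE in Hm Hp *.
    by rewrite [X in X *: d](_ : _ = 1 * l%:Z * B u d + B u d) //; lia.
  by rewrite [X in X *: d](_ : _ = -1 * l%:Z * B u d - B u d) //; lia.
have [k0|k0] := lerP 0 k.
  by have := step `|k|%N 1 (or_introl erefl); rewrite mul1r gez0_abs.
by have := step `|k|%N (-1) (or_intror erefl); rewrite ltz0_abs // mulN1r opprK.
Qed.

Context (a b : U) (Da : D a) (Db : D b) (Bab : B a b = 1).

(** As [B a b = 1], the plane of [a] and [b] splits off orthogonally: by [ptE] and [perp_proj] every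
    vector is some [pt p q x] with [perp x]. *)
Let pt (p q : int) (x : U) := p *: a + q *: b + x.
Let perp x := B x a = 0 /\ B x b = 0.

Let Bba : B b a = -1. Proof. by rewrite BC Bab. Qed.

Let ptDZ p q x k p' q' x' :
  pt p q x + k *: pt p' q' x' = pt (p + k * p') (q + k * q') (x + k *: x').
Proof.
by rewrite /pt !scalerDr !scalerDl !scalerA addrACA [X in X + _ = _]addrACA.
Qed.

Let pta : a = pt 1 0 0. Proof. by rewrite /pt scale1r scale0r !addr0. Qed.
Let ptb : b = pt 0 1 0. Proof. by rewrite /pt scale1r scale0r add0r addr0. Qed.

Let B_pt p q x p' q' x' : perp x -> perp x' ->
  B (pt p q x) (pt p' q' x') = p * q' - q * p' + B x x'.
Proof.
move=> [xa xb] [xa' xb'].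
rewrite /pt !linearDl !linearDr !linearZl_LR !linearZr_LR /=.
rewrite !Bss Bab Bba xa xb (BC _ x') (BC _ x') xa' xb'; ring.
Qed.

Let perp0 : perp 0. Proof. by split; rewrite linear0l. Qed.

Let perpDZ x k y : perp x -> perp y -> perp (x + k *: y).
Proof.
by move=> [xa xb] [ya yb]; split;
  rewrite linearDl linearZl_LR /= ?xa ?xb ?ya ?yb mulr0 addr0.
Qed.

Let ptE v : v = pt (B v b) (- B v a) (v - B v b *: a + B v a *: b).
Proof.
rewrite /pt scaleNr -[v - _ + _]addrA (addrC v) addrA addrACA subrr.
by rewrite addNr addr0 add0r.
Qed.

Let perp_proj v : perp (v - B v b *: a + B v a *: b).
Proof.
split; rewrite linearDl linearBl !linearZl_LR /= Bss ?Bss ?Bab ?Bba; ring.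
Qed.


Let D_transv p q x p' q' x' (k : int) : perp x -> perp x' ->
  D (pt p q x) -> D (pt p' q' x') ->
  let t := k * (p * q' - q * p' + B x x') in
  D (pt (p + t * p') (q + t * q') (x + t *: x')).
Proof.
move=> xP xP' Du Dd /=; rewrite -ptDZ -B_pt //; exact: transvection_expz.
Qed.

Let D_shear_a p q x (k : int) :
  perp x -> D (pt p q x) -> D (pt (p + k * q) q x).
Proof.
move=> xP Du; have Da' : D (pt 1 0 0) by rewrite -pta.
have := D_transv (- k) xP perp0 Du Da'.
by rewrite /= scaler0 addr0 linear0r /= !mulr0 !addr0 mulr1 sub0r mulrNN mulr1.
Qed.

Let D_shear_b p q x (k : int) :
  perp x -> D (pt p q x) -> D (pt p (q + k * p) x).
Proof.
move=> xP Du; have Db' : D (pt 0 1 0) by rewrite -ptb.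
have := D_transv k xP perp0 Du Db'.
by rewrite /= scaler0 addr0 linear0r /= !mulr0 !addr0 !mulr1.
Qed.

(** The transvections along [a] and [b] shear [(p, q)] and fix [x]; three shears compose to a
    quarter turn. *)
Let D_rot p q x : perp x -> D (pt p q x) -> D (pt q (- p) x).
Proof.
move=> xP /(D_shear_a 1 xP) /(D_shear_b (-1) xP) /(D_shear_a 1 xP).
by congr (D (pt _ _ _)); ring.
Qed.

Let X x := perp x /\ D (pt 1 0 x).

Let X_of_b p x : perp x -> D (pt p 1 x) -> X x.
Proof.
move=> xP /(D_shear_a (- p) xP) /(D_rot xP) Dx; split => //.
by move: Dx; congr (D (pt _ _ _)); ring.
Qed.

Let X_of_a s q x : s = 1 \/ s = -1 -> perp x -> D (pt s q x) -> X x.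
Proof.
move=> s1 xP /(D_shear_b (s * (1 - q)) xP) Dx; apply: (@X_of_b s) => //.
by move: Dx; congr (D (pt _ _ _)); case: s1 => ->; ring.
Qed.

Let X_pt s q x : s = 1 \/ s = -1 -> X x -> D (pt s q x).
Proof.
move=> s1 [xP Dx].
have {}Dx : D (pt s 0 x).
  case: s1 => -> //; move: Dx => /(D_rot xP) /(D_rot xP).
  by congr (D (pt _ _ _)); ring.
move: Dx => /(D_shear_b (s * q) xP).
by congr (D (pt _ _ _)); case: s1 => ->; ring.
Qed.

(* The [b]-coefficient of the second vector is free, and is chosen to make the
   pairing of the two vectors equal to [-2 * s]. *)
Let X_add_double s x y : s = 1 \/ s = -1 -> X x -> X y -> X (y + (2 * s) *: x).
Proof.
move=> s1 Xx Xy; have [xP Dx] := Xx; have [yP _] := Xy.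
have Ns1 : - s = 1 \/ - s = -1 by case: s1 => ->; lia.
have := D_transv (-1) yP xP (X_pt (B y x + 2 * s) Ns1 Xy) Dx.
rewrite /= [-1 * _](_ : _ = 2 * s); last by ring.
by apply: (X_of_a (s := _)) => //; [case: s1 => ->; lia | exact: perpDZ].
Qed.

(** A subgroup containing [X], used in place of the span of [X]. *)
Let W z := perp z /\ forall y, X y -> X (y + 2 *: z) /\ X (y - 2 *: z).

Let W0 : W 0.
Proof. by split => // y Xy; rewrite scaler0 subr0 addr0. Qed.

Let WN z : W z -> W (- z).
Proof.
move=> [zP Wz]; split.
  by rewrite -[- z]add0r -scaleN1r; exact: perpDZ.
by move=> y /Wz[]; rewrite scalerN opprK.
Qed.

Let WD z z' : W z -> W z' -> W (z + z').
Proof.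
move=> [zP Wz] [zP' Wz']; split.
  by rewrite -[z']scale1r; exact: perpDZ.
move=> y /Wz[/Wz'[Xp _] /Wz'[_ Xm]].
by rewrite scalerDr opprD !addrA.
Qed.

Let WZ (k : int) z : W z -> W (k *: z).
Proof.
move=> Wz; have Wn (l : nat) : W (l%:Z *: z).
  elim: l => [|l IH]; first by rewrite scale0r.
  by rewrite intS scalerDl scale1r; exact: WD.
have [k0|k0] := lerP 0 k; first by rewrite -(gez0_abs k0).
by rewrite -[k]opprK scaleNr -(ltz0_abs k0); exact: WN.
Qed.

Let XW x : X x -> W x.
Proof.
move=> Xx; split; first by case: Xx.
move=> y Xy; split; first by have := X_add_double (or_introl erefl) Xx Xy.
by rewrite -scaleNr; have := X_add_double (or_intror erefl) Xx Xy.
Qed.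

(** Allowing a nonzero multiple [N] makes [M] stable under division ([M_div]), which [D_M] needs. *)
Let M v := exists (N p q : int) z, [/\ N != 0, W z & N *: v = pt p q z].

Let M0 : M 0.
Proof.
exists 1, 0, 0, 0; split => //.
by rewrite /pt !scale0r scaler0 !addr0.
Qed.

Let MDZ v (k : int) v' : M v -> M v' -> M (v + k *: v').
Proof.
move=> [N [p [q [z [N0 Wz vE]]]]] [N' [p' [q' [z' [N0' Wz' vE']]]]].
exists (N' * N), (N' * p + (N * k) * p'), (N' * q + (N * k) * q'),
  (N' *: z + (N * k) *: z'); split.
- by rewrite mulf_neq0.
- by apply: WD; exact: WZ.
rewrite -ptDZ -vE' scalerDr -scalerA vE !scalerA; congr (_ + _ *: _).
  by rewrite /pt !scalerDr !scalerA.
by ring.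
Qed.

Let M_div v (k : int) : k != 0 -> M (k *: v) -> M v.
Proof.
move=> k0 [N [p [q [z [N0 Wz vE]]]]]; exists (N * k), p, q, z.
by split; rewrite ?mulf_neq0 // -scalerA.
Qed.

(** The Euclidean algorithm on [(p, q)], run by shears and quarter turns, none of which changes
    [x]. *)
Let euclid x p q : perp x -> (p != 0) || (q != 0) -> D (pt p q x) ->
  exists2 g : int, g != 0 & D (pt g 0 x).
Proof.
move=> xP; have [m] := ubnP `|q|%N; elim: m p q => // m IH p q qm.
have [-> | q0 _ Dx] := eqVneq q 0; first by rewrite orbF => p0 Dx; exists p.
have /(D_rot xP) Dr := D_shear_a (- (p %/ q)%Z) xP Dx.
apply: (IH _ _ _ _ Dr); rewrite ?q0 //.
have -> : p + - (p %/ q)%Z * q = (p %% q)%Z by rewrite {1}(divz_eq p q); ring.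
have := modz_ge0 p q0; have := ltz_mod p q0; lia.
Qed.

Let M_proj_neq0 d : D d -> (B d b != 0) || (B d a != 0) -> M d.
Proof.
set x := d - B d b *: a + B d a *: b => Dd d0.
have xP : perp x by exact: perp_proj.
have dE : d = pt (B d b) (- B d a) x by exact: ptE.
have [g g0 Dg] : exists2 g : int, g != 0 & D (pt g 0 x).
  by apply: (@euclid x (B d b) (- B d a)); rewrite -?dE // oppr_eq0.
(* Transvecting [b] along [g a + x] gives [g^2 a + b + g x], whose [b]-coefficient is 1. *)
have Xgx : X (g *: x).
  have Db' : D (pt 0 1 0) by rewrite -ptb.
  have := D_transv (-1) perp0 xP Db' Dg.
  rewrite linear0l /= [-1 * _](_ : _ = g); last by ring.
  rewrite !add0r mulr0 addr0; apply: X_of_b.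
  by rewrite -[g *: x]add0r; exact: perpDZ.
exists g, (g * B d b), (- (g * B d a)), (g *: x); split; [done|exact: XW|].
by rewrite {1}dE /pt !scalerDr !scalerA mulrN.
Qed.

(** The single-orbit condition, phrased as an induction principle. *)
Context (D_connected : forall O : set U,
  (forall d u, D d -> D u -> O u -> O (u - B u d *: d) /\ O (u + B u d *: d)) ->
  O a -> D `<=` O).

Let proj_neq0 u := (B u b != 0) || (B u a != 0).
Let O d := exists u, [/\ D u, proj_neq0 u & B u d != 0].

Let O_adj d e : D d -> D e -> O d -> B d e != 0 -> O e.
Proof.
move=> Dd De [u [Du u0 ud0]] de0.
have [ue0|] := eqVneq (B u e) 0; last by exists u.
have [d0|] := boolP (proj_neq0 d); first by exists d.
rewrite /proj_neq0 negb_or !negbK => /andP[/eqP db0 /eqP da0].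
(* Here [d] is orthogonal to [a] and [b], so the transvection along [d] keeps the plane part of [u]
   while making its pairing with [e] nonzero. *)
exists (u - B u d *: d); split; first by case: (D_transvection Dd Du).
  by rewrite /proj_neq0 !linearBl !linearZl_LR /= db0 da0 !mulr0 !subr0.
by rewrite linearBl linearZl_LR /= ue0 sub0r oppr_eq0 mulf_neq0.
Qed.

Let D_O : D `<=` O.
Proof.
apply: D_connected => [d u Dd Du Ou|]; last first.
  by exists b; split; rewrite // /proj_neq0 Bba ?oppr_eq0 ?oner_eq0 ?orbT.
have [ud0|ud0] := eqVneq (B u d) 0; first by rewrite ud0 scale0r subr0 addr0.
have Od := O_adj Du Dd Ou ud0.
have [Dm Dp] := D_transvection Dd Du.
by split; apply: (O_adj Dd _ Od) => //;
  rewrite BC oppr_eq0 ?linearBl ?linearDl linearZl_LR /= Bss mulr0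
    ?subr0 ?addr0.
Qed.

Let D_M : D `<=` M.
Proof.
move=> d Dd; have [/(M_proj_neq0 Dd)//|] := boolP (proj_neq0 d).
rewrite /proj_neq0 negb_or !negbK => /andP[/eqP db0 /eqP da0].
have [u [Du u0 ud0]] := D_O Dd.
(* [u] and its transvect along [d] have the same nonzero plane part, so both lie in [M]; their
   difference is [B u d *: d]. *)
have Mu := M_proj_neq0 Du u0.
have [Du' _] := D_transvection Dd Du.
have Mu' : M (u - B u d *: d).
  apply: M_proj_neq0 => //.
  by rewrite !linearBl !linearZl_LR /= db0 da0 !mulr0 !subr0.
apply: (M_div ud0); have := MDZ (-1) Mu Mu'.
by rewrite scaleN1r opprB addrC subrK.
Qed.

Lemma radical_translate n (k : 'I_n -> int) (d : 'I_n -> U) :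
  (forall i, D (d i)) -> (forall v, B (\sum_i k i *: d i) v = 0) ->
  exists2 N : int, N != 0 & D (a + N *: \sum_i k i *: d i).
Proof.
move=> Dd; set r := \sum_i _ => r_rad.
have : M r.
  apply: (big_ind M) => [//|u v Mu Mv|i _].
    by rewrite -[v]scale1r; exact: MDZ.
  by rewrite -[_ *: _]add0r; apply: MDZ => //; exact: D_M.
move=> [N [p [q [z [N0 Wz rE]]]]].
have [zP _] := Wz.
(* Pairing with [b] and [a] shows that a radical vector has no plane part, so [N *: r] is [z]
   itself. Translating [0] in [X] by [2 *: z] then explains the witness [2 * N]. *)
have p0 : p = 0.
  have : B (N *: r) (pt 0 1 0) = 0 by rewrite linearZl_LR /= r_rad mulr0.
  by rewrite rE B_pt // linear0r /=; lia.
have q0 : q = 0.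
  have : B (N *: r) (pt 1 0 0) = 0 by rewrite linearZl_LR /= r_rad mulr0.
  by rewrite rE B_pt // linear0r /=; lia.
have zE : z = N *: r by rewrite rE p0 q0 /pt !scale0r !add0r.
exists (2 * N); first by rewrite mulf_neq0.
have X0 : X 0 by split; rewrite -?pta.
have [[_]] := Wz.2 _ X0.
by rewrite add0r zE scalerA /pt scale1r scale0r addr0.
Qed.

End TransvectionInvariantSet.

(** * The form pulled back along the first projection *)

Section PairForm.
Context (V : lmodType int) (B : {biscalar V}) (M : lmodType int).

Definition pair_form (u v : V * M) : int := B u.1 v.1.

Fact pair_form_is_bilinear : bilinear_for
  (GRing.Scale.Law.clone _ _ ( *%R : int -> int -> int) _)
  (GRing.Scale.Law.clone _ _ ( *%R : int -> int -> int) _) pair_form.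
Proof.
split=> [u'|u] k x y; rewrite /pair_form /=.
  by rewrite linearDl linearZl_LR.
by rewrite linearDr linearZr_LR.
Qed.
HB.instance Definition _ := bilinear_isBilinear.Build int (V * M)%type
  (V * M)%type int _ _ pair_form pair_form_is_bilinear.

End PairForm.

(** * Induction over generators, and rational row spaces tested on integer vectors *)

Lemma group_generated_ind (G : groupType) (S P : set G) :
  group_generated S = setT -> P 1%g ->
  (forall g h, P g -> P h -> P (g * h^-1)%g) -> S `<=` P -> forall g, P g.
Proof.
move=> genS P1 PM SP g; have : group_generated S g by rewrite genS.
by apply: smallest_sub => //; split.
Qed.

Lemma common_denominator n (v : 'I_n -> rat) :
  exists2 N : int, N != 0 & exists k : 'I_n -> int,
    forall i, N%:~R * v i = (k i)%:~R.
Proof.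
exists (\prod_i denq (v i)); first by apply/prodf_neq0 => i _; exact: denq_neq0.
exists (fun i => (\prod_(j | j != i) denq (v j)) * numq (v i)) => i.
by rewrite (bigD1 i) //= !intrM numqE mulrAC mulrC [v i * _]mulrC.
Qed.

(** Membership in the row space means killing the columns of [cokermx A]; these lie in the kernel of
    [A] and become integral after clearing denominators. *)
Lemma rat_row_sub_integral m n (A : 'M[rat]_(m, n)) (c : 'rV[rat]_n) :
  (forall k : 'I_n -> int,
    (forall i, \sum_j A i j * (k j)%:~R = 0) -> \sum_j c 0 j * (k j)%:~R = 0) ->
  (c <= A)%MS.
Proof.
move=> cA; rewrite submxE; apply/eqP/matrixP => i j; rewrite ord1 !mxE.
have [N N0 [k kE]] := common_denominator (fun l => cokermx A l j).
apply: (mulfI (x := N%:~R)); first by rewrite intr_eq0.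
rewrite mulr0 mulr_sumr -[RHS](cA k) => [|i'].
  by apply: eq_bigr => l _; rewrite mulrCA kE.
transitivity (N%:~R * (A *m cokermx A) i' j).
  by rewrite mxE mulr_sumr; apply: eq_bigr => l _; rewrite mulrCA kE.
by rewrite mulmx_coker mxE mulr0.
Qed.

(** * Extension of the form and of transvections to [VQ] *)

Section RationalForm.
Context (V : lmodType int) (B : {biscalar V}) (VQ : rationalization V).

Definition form_rat (w v : V) : rat^o := (B v w)%:~R.

Fact form_rat_is_additive w : zmod_morphism (form_rat w).
Proof. by move=> x y; rewrite /form_rat linearBl rmorphB. Qed.
HB.instance Definition _ w :=
  GRing.isZmodMorphism.Build V rat^o (form_rat w) (form_rat_is_additive w).

Definition formQ (w : V) : {linear VQ -> rat^o} :=
  projT1 (cid (rat_universal VQ (form_rat w))).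

Lemma formQE w v : formQ w (rat_map VQ v) = (B v w)%:~R.
Proof. by rewrite /formQ; case: cid => h [hE _] /=; rewrite hE. Qed.

Lemma rat_mapZ (k : int) v : rat_map VQ (k *: v) = k%:~R *: rat_map VQ v.
Proof. by rewrite scaler_int -[in LHS](intz k) scaler_int raddfMz. Qed.

Definition transvectionQ (d : V) (x : VQ) : VQ := x - formQ d x *: rat_map VQ d.

Fact transvectionQ_is_linear d : linear (transvectionQ d).
Proof.
move=> k x y; rewrite /transvectionQ linearP scalerDl scalerBr scalerA opprD.
by rewrite addrACA.
Qed.
HB.instance Definition _ d :=
  GRing.isLinear.Build rat VQ VQ _ (transvectionQ d)
    (transvectionQ_is_linear d).

Lemma rat_act_transvection (G : groupType) (rho : gmodule G V) t d :
  (forall v, rho t v = transvection B d v) ->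
  forall x, rat_act rho VQ t x = transvectionQ d x.
Proof.
move=> tE; apply: rat_linear_ext => v.
by rewrite rat_actE tE /transvection raddfB rat_mapZ /= /transvectionQ formQE.
Qed.

End RationalForm.

(** * Coefficients of a locally trivial cocycle along transvections *)

Section TransvectionCocycle.
Context (V : lmodType int) (B : {biscalar V}) (B_alt : alternating B).
Context (G : groupType) (rho : gmodule G V).
Context (rho_form : forall h u v, B (rho h u) (rho h v) = B u v).
Context (Delta : set V).
Context (Delta_stable : forall h v, Delta v -> Delta (rho h v)).
Context (Delta_orbit : exists2 d, Delta d &
  Delta = [set f d | f in transvection_group B Delta]).
Context (VQ : rationalization V) (phi : G -> VQ).
Context (phiM : forall g h, phi (g * h)%g = rat_act rho VQ g (phi h) + phi g).
Context (phi_disp : forall g, exists x, phi g = rat_act rho VQ g x - x).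

Local Notation iota := (rat_map VQ).
Local Notation act := (rat_act rho VQ).
Let acts t d := forall v, rho t v = transvection B d v.

Let BC u v : B u v = - B v u. Proof. exact: alternating_anticomm. Qed.

Let gactZ h (k : int) v : rho h (k *: v) = k *: rho h v.
Proof. by rewrite -[k]intz !scaler_int raddfMz. Qed.

(** Two points of the orbit are joined through the base point [d0], one path being run backwards;
    hence the equivalence in the hypothesis. *)
Lemma Delta_ind (P : set V) :
  (forall d v, Delta d -> P v <-> P (transvection B d v)) ->
  forall x y, Delta x -> Delta y -> P x -> P y.
Proof.
move=> PT; have [d0 _ DeltaE] := Delta_orbit.
have Pf f : transvection_group B Delta f -> forall v, P v <-> P (f v).
  move: f; apply: smallest_sub; first split=> [//|f g Pf Pg v|f f' Pf fK f'K v].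
  - by rewrite /= -Pf -Pg.
  - by rewrite (Pf (f' v)) f'K.
  by move=> _ [d Dd <-] v; exact: PT.
rewrite DeltaE => x y [f Tf <-] [f' Tf' <-].
by move=> Pfd; apply: (Pf _ Tf' d0).1; exact: (Pf _ Tf d0).2.
Qed.

Lemma cocycleV g : phi g^-1%g = - act g^-1%g (phi g).
Proof.
have phi1 : phi 1%g = 0.
  have := phiM 1 1; rewrite mulg1 rat_act1 => /eqP.
  by rewrite -subr_eq0 opprD addrA subrr sub0r oppr_eq0 => /eqP.
apply/eqP; rewrite -addr_eq0 addrC; have := phiM g^-1%g g.
by rewrite mulVg phi1 => <-.
Qed.

(** A relation, since several group elements may act as the same transvection; [coefficient_unique]
    makes it single-valued on [Delta]. *)
Definition coefficient (d : V) (q : rat) :=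
  exists t, acts t d /\ phi t = q *: iota d.

Lemma cocycle_transvection t d : acts t d -> exists q, phi t = q *: iota d.
Proof.
move=> td; have [x ->] := phi_disp t; exists (- formQ B VQ d x).
by rewrite (rat_act_transvection td) /transvectionQ addrC addKr scaleNr.
Qed.

Lemma coefficient_exists t d : acts t d -> exists q, coefficient d q.
Proof. by move=> td; have [q qE] := cocycle_transvection td; exists q, t. Qed.

Lemma acts_conj t d h : acts t d -> acts (h * t * h^-1)%g (rho h d).
Proof.
move=> td v; rewrite !gactM td /transvection raddfB /= -gactM mulgV gact1.
congr (_ - _); rewrite -(rho_form h) -gactM mulgV gact1.
by rewrite gactZ.
Qed.

(** The cocycle identity gives [phi (h t h^-1) = h (phi t) + (id - h t h^-1) (phi h)], and the last
    term is a multiple of [h d]. *)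
Lemma coefficient_conj h d q : coefficient d q ->
  coefficient (rho h d) (q + formQ B VQ (rho h d) (phi h)).
Proof.
move=> [t [td phiE]]; exists (h * t * h^-1)%g; split; first exact: acts_conj.
rewrite phiM cocycleV linearN -rat_actM.
rewrite (rat_act_transvection (acts_conj h td)) /transvectionQ.
rewrite phiM phiE [act h _]linearZ /= rat_actE.
by rewrite opprB addrACA addNr addr0 addrC scalerDl.
Qed.

Lemma coefficient_transvection h d v p q : phi h = p *: iota d ->
  coefficient v q -> coefficient (rho h v) (q + p *~ B d (rho h v)).
Proof.
move=> phih cv; have := coefficient_conj h cv.
by rewrite phih linearZ /= formQE -(mulrzr p).
Qed.

(** [zmodule rat] is the rationals as a module over [int]. *)
Let lift : set (V * zmodule rat) := fun u => Delta u.1 /\ coefficient u.1 u.2.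

(** The two signs come from conjugating by [t] and by [t^-1], where [t] acts as the transvection
    along [d]. *)
Lemma lift_transvection d u : lift d -> lift u ->
  lift (u - pair_form B u d *: d) /\ lift (u + pair_form B u d *: d).
Proof.
case: d u => [d p] [v q] [/= Dd [t [td phit]]] [/= Dv cv].
have tdV : rho t^-1%g v = v + B v d *: d.
  have -> : v = rho t (v + B v d *: d).
    rewrite td /transvection linearDl linearZl_LR /= B_alt mulr0 addr0.
    by rewrite addrK.
  rewrite -gactM mulVg gact1 td /transvection.
  rewrite linearBl linearDl !linearZl_LR /= B_alt.
  by rewrite !(mulr0, addr0, subr0) subrK.
have tVd : rho t^-1%g d = d.
  have {1}-> : d = rho t d by rewrite td /transvection B_alt scale0r subr0.
  by rewrite -gactM mulVg gact1.
have phitV' : phi t^-1%g = (- p) *: iota d.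
  by rewrite cocycleV phit linearZ /= rat_actE tVd scaleNr.
split; split; rewrite /pair_form /= -?tdV; [| |exact: Delta_stable|].
- by rewrite -[_ - _]td; exact: Delta_stable.
- have := coefficient_transvection phit cv; rewrite td.
  have -> : B d (transvection B d v) = - B v d.
    by rewrite BC /transvection linearBl linearZl_LR /= B_alt mulr0 subr0.
  by rewrite mulrNz.
have := coefficient_transvection phitV' cv.
have -> : B d (rho t^-1%g v) = - B v d.
  by rewrite tdV linearDr linearZr_LR /= B_alt mulr0 addr0 BC.
by rewrite mulNrNz.
Qed.

Lemma coefficient_radical v r q q' w : (forall u, B r u = 0) -> B v w != 0 ->
  coefficient v q -> coefficient (v + r) q' -> q = q'.
Proof.
move=> r_rad vw0 [t [tv phit]] [t' [tv' phit']].
pose s := (t' * t^-1)%g.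
(* On any [y], the actions of [t] and [t'] differ by a multiple of the radical vector [r]. *)
have sE x : B (rho s x) w = B x w.
  have {2}-> : x = rho t (rho t^-1%g x) by rewrite -gactM mulgV gact1.
  rewrite gactM tv tv' /transvection linearDr /= [B _ r]BC r_rad subr0.
  by rewrite !linearBl !linearZl_LR linearDl /= r_rad addr0.
have sQ x : formQ B VQ w (act s x) = formQ B VQ w x.
  apply: (rat_linear_ext (h := formQ B VQ w \o act s)) => u /=.
  by rewrite rat_actE !formQE sE.
have [x phisE] := phi_disp s.
have : formQ B VQ w (phi s) = 0 by rewrite phisE linearB /= sQ subrr.
rewrite phiM cocycleV linearN -rat_actM linearD linearN /= sQ phit phit'.
rewrite !linearZ /= !formQE linearDl /= r_rad addr0 addrC scalerN.
rewrite -scalerBl => /eqP.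
by rewrite scaler_eq0 intr_eq0 (negPf vw0) orbF subr_eq0 => /eqP.
Qed.

Context (Delta_acts : forall d, Delta d -> exists t, acts t d).
Context (a b : V) (Da : Delta a) (Db : Delta b) (Bab : B a b = 1).

Lemma Delta_nonradical v : Delta v -> exists w, B v w != 0.
Proof.
move=> Dv; apply: (Delta_ind (P := fun v => exists w, B v w != 0)) Da Dv _;
  last first.
  by exists b; rewrite Bab.
move=> d u _; rewrite /transvection; split=> -[w uw0].
  (* Transvections are isometries: [w] is moved along with [u] here, and by the inverse transvection
     in the converse. *)
  exists (w - B w d *: d); move: uw0; congr (_ != 0).
  rewrite linearBl linearZl_LR !linearBr !linearZr_LR /= B_alt (BC d w); ring.
exists (w + B w d *: d); move: uw0; congr (_ != 0).
by rewrite linearBl linearZl_LR linearDr linearZr_LR /= (BC d w); ring.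
Qed.

Lemma coefficient_unique v q q' : Delta v ->
  coefficient v q -> coefficient v q' -> q = q'.
Proof.
move=> /Delta_nonradical[w vw0] cq cq'.
apply: (@coefficient_radical v 0) vw0 cq _.
  by move=> u; rewrite linear0l.
by rewrite addr0.
Qed.

(** A path in [Delta] lifts step by step; uniqueness of coefficients forces the lift to end at the
    prescribed point. *)
Lemma lift_connected u (O : set (V * zmodule rat)) : lift u ->
  (forall d v, lift d -> lift v -> O v ->
    O (v - pair_form B v d *: d) /\ O (v + pair_form B v d *: d)) ->
  O u -> lift `<=` O.
Proof.
case: u => [u p] Du OT Ou [v q] [/= Dv cv].
pose P v := exists q : zmodule rat, lift (v, q) /\ O (v, q).
have : P v.
  apply: Delta_ind (Du.1 : Delta u) Dv _; last by exists p.
  move=> d w Dd; have [t /coefficient_exists[r cr]] := Delta_acts Dd.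
  have Ddr : lift (d, r) by [].
  split=> -[s [Ds Os]].
    exists (s - B w d *: (r : zmodule rat)).
    by split; [case: (lift_transvection Ddr Ds) | case: (OT _ _ Ddr Ds Os)].
  exists (s + B (transvection B d w) d *: (r : zmodule rat)).
  have wE : w = transvection B d w + B (transvection B d w) d *: d.
    by rewrite /transvection linearBl linearZl_LR /= B_alt mulr0 subr0 subrK.
  rewrite {1 3}wE.
  by split; [case: (lift_transvection Ddr Ds) | case: (OT _ _ Ddr Ds Os)].
by move=> [q' [[_ cq'] Oq']]; rewrite (coefficient_unique Dv cv cq').
Qed.

Lemma coefficient_relation n
  (k : 'I_n -> int) (d : 'I_n -> V) (c : 'I_n -> rat) :
  (forall j, Delta (d j)) -> (forall j, coefficient (d j) (c j)) ->
  (forall v, B (\sum_j k j *: d j) v = 0) -> \sum_j (k j)%:~R * c j = 0.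
Proof.
move=> Dd cd r_rad.
have [ta /coefficient_exists[p cp]] := Delta_acts Da.
have [tb /coefficient_exists[q cq]] := Delta_acts Db.
pose dc j : V * zmodule rat := (d j, c j).
have dcE : \sum_j k j *: dc j =
    (\sum_j k j *: d j, \sum_j k j *: (c j : zmodule rat)).
  by apply: (big_rec3 (fun x y z => z = (x, y))) => // j x y _ _ ->.
pose pf : {biscalar (V * zmodule rat)%type} := @pair_form V B (zmodule rat).
have pf_alt : alternating pf by move=> u; exact: B_alt.
have La : lift (a, p) by [].
have Lb : lift (b, q) by [].
have [N N0 [_ /= cN]] : exists2 N : int, N != 0 &
    lift ((a, p) + N *: \sum_j k j *: dc j).
  (* Second coordinates do not affect [pf], so the lifted sum is radical as soon as its first
     coordinate is. *)
  apply: (@radical_translate _ pf pf_alt lift lift_transvection _ _ La Lb Bab).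
  - by move=> O OT; exact: lift_connected.
  - by move=> j; split; [exact: Dd | exact: cd].
  by move=> v; rewrite dcE; exact: r_rad.
rewrite dcE /= in cN.
have b0 : B a b != 0 by rewrite Bab.
have r0 u : B (N *: \sum_j k j *: d j) u = 0.
  by rewrite linearZl_LR /= r_rad mulr0.
have /eqP := coefficient_radical r0 b0 cp cN.
rewrite -subr_eq0 opprD addrA subrr sub0r oppr_eq0 scalezrE.
rewrite mulrz_eq0 (negPf N0) /=.
move=> /eqP sum0; rewrite -[RHS]sum0; apply: eq_bigr => j _.
by rewrite scalezrE mulrzl.
Qed.


End TransvectionCocycle.

(** * From local to global coboundaries *)

Theorem proposition12
  (V : lmodType int) (V_free : free_of_finite_rank V)
  (B : {biscalar V}) (B_alt : alternating B)
  (G : groupType) (rho : gmodule G V)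
  (n : nat) (g : 'I_n -> G) (e : 'I_n -> V)
  (g_gen : group_generated (range g) = setT)
  (g_act : forall i v, rho (g i) v = v - B v (e i) *: e i)
  (Delta_van : vanishing_lattice B [set rho h v | h in setT & v in range e])
  (VQ : rationalization V) :
  injective (restriction (rat_gmodule rho VQ)).
Proof.
move=> c1 c2 c12.
pose phi := val (repr c1 - repr c2).
have phiM x y : phi (x * y)%g = rat_act rho VQ x (phi y) + phi x.
  by have /asboolP := valP (repr c1 - repr c2); apply.
have phi_disp x : exists y, phi x = rat_act rho VQ x y - y.
  have /eqP := congr1 (fun f => f x) c12.
  by rewrite -Quotient.idealrBE => /asboolP.
suff [x xP] : exists x, forall h, phi h = rat_act rho VQ h x - x.
  rewrite -[c1]reprK -[c2]reprK; apply/eqP; rewrite -Quotient.idealrBE.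
  by apply/asboolP; exists x.
have BC := alternating_anticomm B_alt.
set Delta := [set rho h v | h in setT & v in range e] in Delta_van.
have [_ Delta_orbit [a [b [Da Db Bab]]]] := Delta_van.
have rho_form h u v : B (rho h u) (rho h v) = B u v.
  move: h u v; apply: (group_generated_ind g_gen)
    => [u v|h h' IH IH' u v|_ [i _ <-] u v].
  - by rewrite !gact1.
  - by rewrite !gactM IH -IH' -!gactM mulgV !gact1.
  rewrite !g_act !(linearBl, linearBr) !(linearZl_LR, linearZr_LR) /= B_alt.
  by rewrite (BC (e i) v); ring.
have De i : Delta (e i).
  by exists 1%g => //; exists (e i); [exists i | rewrite gact1].
have Delta_stable h v : Delta v -> Delta (rho h v).
  move=> [h' _ [w ew <-]]; exists (h * h')%g => //.
  by exists w; rewrite // gactM.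
have Delta_acts d : Delta d -> exists t, forall v, rho t v = transvection B d v.
  move=> [h _ [_ [i _ <-] <-]]; exists (h * g i * h^-1)%g.
  by apply: acts_conj => // v; rewrite g_act.
have cex i : {q : rat | phi (g i) = q *: rat_map VQ (e i)}.
  by apply: cid; exact: (cocycle_transvection phi_disp (g_act i)).
pose c i := sval (cex i).
have cP i : phi (g i) = c i *: rat_map VQ (e i) := svalP (cex i).
have cc i : coefficient B rho phi (e i) (c i) by exists (g i).
(* A vector [x] trivializing [phi] must satisfy [formQ (e i) x = - c i] for all [i]. For [x] a
   combination of the [e j] with coefficients [y], anticommutativity turns this into
   [c = y *m A]. *)
pose A := \matrix_(i < n, j < n) (B (e j) (e i))%:~R : 'M[rat]_n.
have /submxP[y yE] : (\row_j c j <= A)%MS.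
  apply: rat_row_sub_integral => k kA.
  (* Orthogonality to every [e i] makes pairing with the sum invariant under [G], so it vanishes on
     [Delta], which spans [V]. *)
  have k_rad v : B (\sum_j k j *: e j) v = 0.
    have rE i : B (\sum_j k j *: e j) (e i) = 0.
      apply/eqP; rewrite -(intr_eq0 rat) -(kA i) BC linear_sum /= -sumrN.
      rewrite rmorph_sum.
      apply/eqP; apply: eq_bigr => j _.
      by rewrite mxE linearZr_LR /= BC -mulrN opprK intrM mulrC.
    have rM h u :
        B (\sum_j k j *: e j) (rho h u) = B (\sum_j k j *: e j) u.
      move: h u; apply: (group_generated_ind g_gen)
        => [u|h h' IH IH' u|_ [i _ <-] u].
      - by rewrite gact1.
      - by rewrite gactM IH -IH' -gactM mulgV gact1.
      by rewrite g_act linearBr linearZr_LR /= rE mulr0 subr0.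
    have : span_int Delta v by case: Delta_van => ->.
    move: v; apply: smallest_sub; first split=> [|m u w /= uE wE].
    - exact: linear0r.
    - by rewrite linearDr linearZr_LR /= uE wE mulr0 addr0.
    by move=> _ [h _ [_ [i _ <-] <-]]; rewrite /= rM rE.
  rewrite -[RHS](coefficient_relation B_alt rho_form Delta_stable Delta_orbit
    phiM phi_disp Delta_acts Da Db Bab De cc k_rad).
  by apply: eq_bigr => j _; rewrite mxE mulrC.
pose x := \sum_j y 0 j *: rat_map VQ (e j).
(* The elements on which [phi] agrees with the coboundary of [x] form a subgroup, so generators
   suffice. *)
exists x; apply: (group_generated_ind g_gen) => [|h h' hE hE'|_ [i _ <-]].
- have := phiM 1%g 1%g; rewrite mulg1 !rat_act1 subrr => /eqP.
  by rewrite -subr_eq0 opprD addrA subrr sub0r oppr_eq0 => /eqP.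
- have phiV : phi h'^-1%g = rat_act rho VQ h'^-1%g x - x.
    by rewrite (cocycleV phiM) hE' linearB /= -rat_actM mulVg rat_act1 opprB.
  by rewrite phiM phiV hE linearB /= -rat_actM addrA subrK.
rewrite (rat_act_transvection (g_act i)) /transvectionQ addrC addKr cP -scaleNr.
congr (_ *: _); rewrite /x linear_sum /=.
have /matrixP/(_ 0 i) := yE; rewrite !mxE => ->.
rewrite -sumrN; apply: eq_bigr => j _; rewrite mxE linearZ /= formQE.
by rewrite BC rmorphN -scalerN.
Qed.
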